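(* Let $H$ and $K$ be non-zero complex Hilbert spaces, let $A\in\mathbb{B}(K,H)$ and $a,b,c\in\mathbb{C}$, and let $$T=\begin{pmatrix} aI_H & A\\ cA^* & bI_K\end{pmatrix}\in\mathbb{B}(H\oplus K).$$ Then the following statements are equivalent: (i) $T$ attains its norm; (ii) $A$ attains its norm.
   Context: $\mathbb{B}(K,H)$ denotes the set of bounded linear operators from $K$ to $H$, and $\mathbb{B}(H)=\mathbb{B}(H,H)$. $H\oplus K$ is the Hilbert space direct sum, with inner product $\langle (x_1,y_1)^T,(x_2,y_2)^T\rangle=\langle x_1,x_2\rangle+\langle y_1,y_2\rangle$. $I_H$, $I_K$ are the identity operators and $A^*$ is the adjoint of $A$. A bounded linear operator $B$ between Hilbert spaces attains its norm if there is a unit vector $x$ in its domain with $\|Bx\|=\|B\|$. *)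

(* Defs.v *)
From HB Require Import structures.
From mathcomp Require Import all_boot all_order all_algebra.
From mathcomp Require Import sesquilinear complex.
From mathcomp Require Import all_classical all_reals all_analysis.

From mathcomp Require Import ring lra.

Set Implicit Arguments.
Unset Strict Implicit.
Unset Printing Implicit Defensive.

Import Order.TTheory GRing.Theory Num.Theory.
Import numFieldNormedType.Exports.

Local Open Scope classical_set_scope.
Local Open Scope complex_scope.
Local Open Scope ring_scope.

(* [{dot V for Num.conj}] forms are linear in the first argument and
   conjugate-linear in the second. *)
HB.mixin Record NormedModule_hasInner (R : realType) V
    & NormedModule R[i] V := {
  inner : {dot V for Num.conj} ;
  inner_norm : forall x : V, `|x| ^+ 2 = inner x x }.

#[short(type="hilbertType")]
HB.structure Definition Hilbert (R : realType) :=
  {V of CompleteNormedModule R[i] V & NormedModule_hasInner R V}.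

HB.mixin Record isBoundedMap (R : realType) (U V : normedModType R[i])
    (f : U -> V) := {
  bounded_mapP : exists M : R[i], forall x, `|f x| <= M * `|x| }.

HB.structure Definition BoundedLinear (R : realType)
    (U V : normedModType R[i]) :=
  {f of @GRing.Linear R[i] U V *:%R f & isBoundedMap R U V f}.

Notation "{ 'bounded' U -> V }" := (@BoundedLinear.type _ U%type V%type)
  (at level 0, U at level 98, V at level 99,
   format "{ 'bounded'  U  ->  V }") : type_scope.

Section DotTheory.
Variables (C : numClosedFieldType) (U : lmodType C) (form : {dot U for Num.conj}).

Lemma dot_CauchySchwarz u v : `|form u v| ^+ 2 <= form u u * form v v.
Proof.
have [->|v0] := eqVneq v 0; first by rewrite !linear0r normr0 expr0n.
pose w := form v v *: u - form u v *: v.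
have vgt0 : 0 < form v v by rewrite dnorm_gt0.
have : 0 <= form w w by exact: dnorm_ge0.
have -> : form w w = form v v * (form u u * form v v - `|form u v| ^+ 2).
  have dE : form (form v v *: u) (form u v *: v)
      = form v v * ((form u v)^* * form u v).
    by rewrite linearZl_LR/= linearZr_LR.
  rewrite /w dnormB !dnormZ dE (ger0_norm (ltW vgt0)) !normCK.
  rewrite !rmorphM/= conjCK (CrealP (ger0_real (ltW vgt0))).
  ring.
by rewrite pmulr_rge0// subr_ge0.
Qed.

Lemma dot_triangle u v :
  sqrtC (form (u + v) (u + v)) <= sqrtC (form u u) + sqrtC (form v v).
Proof.
rewrite -(@ler_pXn2r _ 2)// ?nnegrE ?addr_ge0 ?sqrt_dnorm_ge0//.
rewrite sqrrD !sqrtCK dnormD addrAC lerD2r lerD2l.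
have dle : `|form u v| <= sqrtC (form u u) * sqrtC (form v v).
  rewrite -(@ler_pXn2r _ 2)// ?nnegrE ?mulr_ge0 ?sqrt_dnorm_ge0//.
  by rewrite exprMn !sqrtCK dot_CauchySchwarz.
apply: le_trans (_ : `|form u v| *+ 2 <= _); last by rewrite lerMn2r dle orbT.
apply: le_trans (real_ler_norm _) _.
  by apply/CrealP; rewrite rmorphD/= conjCK addrC.
by rewrite (le_trans (ler_normD _ _))// norm_conjC mulr2n.
Qed.
End DotTheory.

Section HilbertSum.
Variables (R : realType) (H K : hilbertType R).

(* The product type [H * K] already carries the maximum norm, so the Hilbert
   direct sum needs its own copy. *)
Definition hsum : Type := (H * K)%type.

HB.instance Definition _ := GRing.Lmodule.copy hsum (H * K)%type.

Definition hsum_inner (z w : hsum) : R[i] :=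
  inner z.1 w.1 + inner z.2 w.2.

Fact hsum_inner_bilinear : bilinear_for
  (GRing.Scale.Law.clone _ _ *%R _)
  (GRing.Scale.Law.clone _ _ (Num.conj \; *%R) _) hsum_inner.
Proof.
split=> z a u v; rewrite /hsum_inner/=.
  rewrite !linearPl/=; ring.
rewrite !linearPr/=; ring.
Qed.

HB.instance Definition _ := bilinear_isBilinear.Build R[i] hsum hsum R[i]
  *%R (Num.conj \; *%R) hsum_inner hsum_inner_bilinear.

Fact hsum_inner_herm z w :
  hsum_inner z w = (-1) ^+ false * (hsum_inner w z)^*.
Proof.
by rewrite /hsum_inner (hermC _ z.1) (hermC _ z.2) expr0 !mul1r rmorphD.
Qed.

HB.instance Definition _ := isHermitianSesquilinear.Build R[i] hsum false
  Num.conj hsum_inner hsum_inner_herm.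

Fact hsum_inner_gt0 z : z != 0 -> 0 < hsum_inner z z.
Proof.
move=> z0; rewrite lt_def addr_ge0// andbT; apply: contra z0.
rewrite paddr_eq0// !dnorm_eq0 => /andP[/eqP z1 /eqP z2].
by apply/eqP; rewrite [z]surjective_pairing z1 z2.
Qed.

HB.instance Definition _ := isDotProduct.Build R[i] hsum hsum_inner
  hsum_inner_gt0.

Definition hsum_norm (z : hsum) : R[i] := sqrtC (hsum_inner z z).

Fact hsum_norm_triangle z w : hsum_norm (z + w) <= hsum_norm z + hsum_norm w.
Proof. exact: (dot_triangle hsum_inner). Qed.

Fact hsum_normZ (l : R[i]) z : hsum_norm (l *: z) = `|l| * hsum_norm z.
Proof.
rewrite /hsum_norm (dnormZ hsum_inner) sqrtCM ?nnegrE ?exprn_ge0//.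
by rewrite sqrCK.
Qed.

Fact hsum_norm_eq0 z : hsum_norm z = 0 -> z = 0.
Proof. by move/eqP; rewrite (sqrt_dnorm_eq0 hsum_inner) => /eqP. Qed.

HB.instance Definition _ := Lmodule_isNormed.Build R[i] hsum
  hsum_norm_triangle hsum_normZ hsum_norm_eq0.

Fact hsum_inner_normE (z : hsum) : `|z| ^+ 2 = hsum_inner z z.
Proof. exact: sqrtCK. Qed.

Lemma hsum_norm_sqr (z : hsum) : `|z| ^+ 2 = `|z.1| ^+ 2 + `|z.2| ^+ 2.
Proof. by rewrite hsum_inner_normE /hsum_inner -!inner_norm. Qed.

Lemma ler_norm_hsum1 (z : hsum) : `|z.1| <= `|z|.
Proof.
by rewrite -(@ler_pXn2r _ 2)// ?nnegrE// hsum_norm_sqr lerDl exprn_ge0.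
Qed.

Lemma ler_norm_hsum2 (z : hsum) : `|z.2| <= `|z|.
Proof.
by rewrite -(@ler_pXn2r _ 2)// ?nnegrE// hsum_norm_sqr lerDr exprn_ge0.
Qed.

Lemma ler_norm_hsum (z : hsum) : `|z| <= `|z.1| + `|z.2|.
Proof.
rewrite -(@ler_pXn2r _ 2)// ?nnegrE ?addr_ge0// hsum_norm_sqr sqrrD.
by rewrite lerD2r lerDl mulrn_wge0// mulr_ge0.
Qed.

Fact hsum_complete (F : set_system hsum) :
  ProperFilter F -> cauchy F -> cvg F.
Proof.
move=> FF /cauchyP Fc.
have c1 : cvg (fst @ F).
  apply: cauchy_cvg; apply: cauchy_exP => e e0; have [z Fz] := Fc _ e0.
  exists z.1; suff : F [set w : hsum | ball z.1 e w.1] by [].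
  apply: filterS Fz => w /=; rewrite -!ball_normE/=.
  exact: le_lt_trans (ler_norm_hsum1 (z - w)).
have c2 : cvg (snd @ F).
  apply: cauchy_cvg; apply: cauchy_exP => e e0; have [z Fz] := Fc _ e0.
  exists z.2; suff : F [set w : hsum | ball z.2 e w.2] by [].
  apply: filterS Fz => w /=; rewrite -!ball_normE/=.
  exact: le_lt_trans (ler_norm_hsum2 (z - w)).
apply/cvg_ex; exists ((lim (fst @ F), lim (snd @ F)) : hsum).
apply/cvgrPdist_lt => e e0; near=> w.
apply: le_lt_trans (ler_norm_hsum _) _; rewrite [ltRHS]splitr ltrD//=.
- by near: w; move/cvgrPdist_lt : c1; apply; rewrite divr_gt0.
- by near: w; move/cvgrPdist_lt : c2; apply; rewrite divr_gt0.
Unshelve. all: by end_near. Qed.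

HB.instance Definition _ := Uniform_isComplete.Build hsum hsum_complete.

HB.instance Definition _ := NormedModule_hasInner.Build R hsum hsum_inner_normE.

End HilbertSum.

Lemma le_small_eq0 (T : realFieldType) (G c : T) : 0 <= G -> 0 < c ->
  (forall e, 0 < e < 1 -> G <= e * c) -> G = 0.
Proof.
move=> G0 c0 h; apply/eqP; rewrite eq_le G0 andbT leNgt; apply/negP => G1.
have q0 : 0 < 2 * (c + G) by lra.
have /h : 0 < G / (2 * (c + G)) < 1.
  by rewrite divr_gt0//= ltr_pdivrMr//; lra.
rewrite mulrAC ler_pdivlMr//; nra.
Qed.

Section Riesz.
Variables (R : realType) (U : hilbertType R).
Implicit Types (x y z : U) (t : R).

Let nr x : R := complex.Re `|x|.
Let ip x y : R := complex.Re (inner x y).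

Let normE x : `|x| = (nr x)%:C.
Proof. by rewrite /nr RRe_real// ger0_real. Qed.

Let nr_ge0 x : 0 <= nr x.
Proof. by rewrite -ler0c -normE. Qed.

Let nr2 x : nr x ^+ 2 = ip x x.
Proof. by rewrite /ip -inner_norm normE -rmorphXn. Qed.

Let ReD (u v : R[i]) : complex.Re (u + v) = complex.Re u + complex.Re v.
Proof. by case: u v => [? ?] [? ?]. Qed.

Let ReZ t (u : R[i]) : complex.Re (t%:C * u) = t * complex.Re u.
Proof. by case: u => [? ?] /=; rewrite mul0r subr0. Qed.

Let ipDl x y z : ip (x + y) z = ip x z + ip y z.
Proof. by rewrite /ip linearDl ReD. Qed.

Let ipZl t x y : ip (t%:C *: x) y = t * ip x y.
Proof. by rewrite /ip linearZl_LR ReZ. Qed.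

Let ipC x y : ip x y = ip y x.
Proof.
apply: complexI; rewrite !complexRe (hermC _ x) expr0 mul1r.
exact: Re_conj.
Qed.

Let ipDr x y z : ip x (y + z) = ip x y + ip x z.
Proof. by rewrite ipC ipDl !(ipC x). Qed.

Let ipZr t x y : ip x (t%:C *: y) = t * ip x y.
Proof. by rewrite ipC ipZl (ipC x). Qed.

Let ipCS x y : ip x y ^+ 2 <= ip x x * ip y y.
Proof.
have := dot_CauchySchwarz inner x y.
rewrite -add_Re2_Im2 -!inner_norm !normE -!rmorphXn -rmorphM lecR.
by rewrite !nr2; apply: le_trans; rewrite lerDl sqr_ge0.
Qed.

Variable f : U -> R[i].
Hypothesis f_linear : forall a x y, f (a *: x + y) = a * f x + f y.
Hypothesis f_bounded : exists M : R[i], forall x, `|f x| <= M * `|x|.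

Let rf x : R := complex.Re (f x).

Let fD x y : f (x + y) = f x + f y.
Proof. by rewrite -[x in f (x + _)]scale1r f_linear mul1r. Qed.

Let f0 : f 0 = 0.
Proof. by apply: (addrI (f 0)); rewrite -fD !addr0. Qed.

Let fZ a x : f (a *: x) = a * f x.
Proof. by rewrite -[_ *: x]addr0 f_linear f0 addr0. Qed.

Let rfD x y : rf (x + y) = rf x + rf y. Proof. by rewrite /rf fD ReD. Qed.

Let rfZ t x : rf (t%:C *: x) = t * rf x. Proof. by rewrite /rf fZ ReZ. Qed.

Let J x : R := ip x x - 2 * rf x.

Let JDZ x z t :
  J (x + t%:C *: z) = J x + (t ^+ 2 * ip z z + 2 * t * (ip x z - rf z)).
Proof.
rewrite /J rfD rfZ ipDl !ipDr !ipZl !ipZr (ipC z x); ring.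
Qed.

Let J_lb : exists m : R, forall x, m <= J x.
Proof.
have [M fM] := f_bounded; exists (- complex.Re M ^+ 2) => x.
have h : rf x <= complex.Re M * nr x.
  have := fM x; rewrite lecE => /andP[_].
  have -> : complex.Re (M * `|x|) = complex.Re M * nr x.
    by rewrite mulrC normE ReZ mulrC.
  apply: le_trans; apply: le_trans (ler_norm _) _.
  rewrite -lecR; apply: le_trans (normc_ge_Re _) _.
  by rewrite RRe_real// ger0_real.
rewrite /J -nr2; have := sqr_ge0 (nr x - complex.Re M); nra.
Qed.

Let d : R := inf (range J).

Let d_le x : d <= J x.
Proof.
have [m hm] := J_lb; apply: ge_inf; last by exists x.
by exists m => _ [y _ <-].
Qed.

Let d_adh (e : R) : 0 < e -> exists x, J x < d + e.
Proof.
move=> e0; have [m hm] := J_lb.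
have hi : has_inf (range J).
  by split; [exists (J 0), 0|exists m => _ [y _ <-]].
by have [_ [x _ <-] ?] := inf_adherent e0 hi; exists x.
Qed.

Let parallelogram (e : R) x y :
  J x < d + e -> J y < d + e -> ip (x - y) (x - y) <= 4 * e.
Proof.
move=> xe ye; have := d_le (x + (2^-1)%:C *: (y - x)).
have -> : x - y = (-1)%:C *: (y - x).
  by rewrite rmorphN rmorph1 scaleN1r opprB.
rewrite !JDZ ipZl ipZr; move: ye.
have -> : J y = J (x + 1%:C *: (y - x)) by rewrite rmorph1 scale1r addrC subrK.
rewrite JDZ; move: (ip _ _) (ip _ _) (rf _) => q g h; nra.
Qed.

Lemma riesz_representation : exists y, forall x, f x = inner x y.
Proof.
pose F : set_system U :=
  filter_from [set e : R | 0 < e] (fun e => [set x | J x < d + e]).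
have FF : ProperFilter F.
  apply: filter_from_proper; last by move=> e /d_adh.
  apply: filter_from_filter; first by exists 1 => /=.
  move=> e1 e2 /= e10 e20; exists (Num.min e1 e2).
    by rewrite /= lt_min e10.
  by move=> x /=; rewrite -ltrBlDl lt_min !ltrBlDl => /andP[].
have /cauchy_cvg/cvg_ex[y yF] : cauchy F.
  apply: cauchy_exP => e e0.
  have eE : e = (complex.Re e)%:C by rewrite RRe_real// gtr0_real.
  have r0 : 0 < complex.Re e by rewrite -ltcR -eE.
  have r'0 : 0 < complex.Re e ^+ 2 / 8 by rewrite divr_gt0// exprn_gt0.
  have [x xd] := d_adh r'0; exists x; exists (complex.Re e ^+ 2 / 8) => //.
  move=> z /= zd; rewrite -ball_normE/= normE eE ltcR.
  rewrite -(@ltr_pXn2r _ 2)// ?nnegrE ?(ltW r0)// nr2.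
  apply: le_lt_trans (parallelogram xd zd) _.
  by have := exprn_gt0 2 r0; lra.
have Fy (e : R[i]) : 0 < e -> F (ball y e).
  by move=> e0; apply: yF; exact: nbhsx_ballx.
have re z : ip y z = rf z.
  have key (e : R) : 0 < e < 1 ->
      (ip y z - rf z) ^+ 2 <= e * (4 * ip z z + 2).
    move=> /andP[e0 e1].
    have eC0 : 0 < e%:C by rewrite ltcR.
    have FJ : F [set x | J x < d + e] by exists e.
    have [x [/= xd]] := filter_ex (filterI FJ (Fy _ eC0)).
    rewrite -ball_normE/= normE ltcR => yx.
    have yx2 : ip (y - x) (y - x) <= e.
      rewrite -nr2; have := nr_ge0 (y - x); nra.
    have q0 : 0 <= ip z z by rewrite -nr2 sqr_ge0.
    set q := ip z z in q0 *.
    set g := ip x z - rf z.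
    have g2 : g ^+ 2 <= e * (q + 1).
      have := d_le (x + (- g / (q + 1))%:C *: z).
      rewrite JDZ -/g -/q => h.
      have {}h : - e < (- g / (q + 1)) ^+ 2 * q + 2 * (- g / (q + 1)) * g by lra.
      have qp : 0 < q + 1 by lra.
      have hh : (- g / (q + 1)) ^+ 2 * q + 2 * (- g / (q + 1)) * g
          = - (g ^+ 2 * (q + 2) / (q + 1) ^+ 2).
        by field; rewrite gt_eqF.
      rewrite hh ltrN2 ltr_pdivrMr ?exprn_gt0// in h.
      have := sqr_ge0 g; nra.
    have gG : ip y z - rf z = g + ip (y - x) z.
      have -> : ip y z = ip (y - x + x) z by rewrite subrK.
      rewrite ipDl /g; ring.
    have := ipCS (y - x) z; rewrite -/q gG; set k := ip (y - x) z => k2.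
    have k3 : k ^+ 2 <= e * q by apply: le_trans k2 _; rewrite ler_wpM2r.
    have := sqr_ge0 (g - k); nra.
  apply/eqP; rewrite -subr_eq0 -sqrf_eq0; apply/eqP.
  apply: le_small_eq0 key; first exact: sqr_ge0.
  by rewrite -nr2; have := sqr_ge0 (nr z); lra.
exists y => x; have := re ('i%C *: x); have := re x.
rewrite !(ipC y) /ip /rf fZ linearZl_LR/=.
case: (inner x y) (f x) => [p q] [r s] /= -> /eqP.
by rewrite !mul0r !mul1r !sub0r eqr_opp => /eqP ->.
Qed.

End Riesz.

Section BoundedTheory.
Variables (R : realType) (U V W : normedModType R[i]).

Lemma bounded_map_ge0 (f : {bounded U -> V}) :
  exists2 M : R[i], 0 <= M & forall x, `|f x| <= M * `|x|.
Proof.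
have [M fM] := @bounded_mapP _ _ _ f; exists `|M| => // x.
have M0 : 0 <= M * `|x| by apply: le_trans (fM x).
by rewrite -[X in _ * X]normr_id -normrM ger0_norm.
Qed.

Fact idfun_bounded : exists M : R[i], forall x : U, `|idfun x| <= M * `|x|.
Proof. by exists 1 => x; rewrite mul1r. Qed.

HB.instance Definition _ := isBoundedMap.Build R U U idfun idfun_bounded.

Variables (a : R[i]) (f : {bounded U -> V}).

Fact scale_fun_bounded : exists M : R[i], forall x, `|(a \*: f) x| <= M * `|x|.
Proof.
have [M M0 fM] := bounded_map_ge0 f; exists (`|a| * M) => x.
by rewrite /= normrZ -mulrA ler_wpM2l.
Qed.

HB.instance Definition _ := isBoundedMap.Build R U V (a \*: f)
  scale_fun_bounded.

End BoundedTheory.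

Section Adjoint.
Variables (R : realType) (U V : hilbertType R) (f : {bounded U -> V}).

Fact adjoint_exists (y : V) : exists z : U, forall x, inner (f x) y = inner x z.
Proof.
have [M M0 fM] := bounded_map_ge0 f.
apply: riesz_representation => [a u v|]; first by rewrite linearP linearPl.
exists (M * `|y|) => x.
rewrite -(@ler_pXn2r _ 2)// ?nnegrE ?mulr_ge0//.
apply: le_trans (dot_CauchySchwarz _ _ _) _.
rewrite -!inner_norm -exprMn ler_pXn2r ?nnegrE ?mulr_ge0//.
by rewrite mulrAC ler_wpM2r.
Qed.

Definition adjoint (y : V) : U := projT1 (cid (adjoint_exists y)).

Lemma adjointE x y : inner (f x) y = inner x (adjoint y).
Proof. by rewrite /adjoint; case: cid. Qed.

Lemma inner_injr (u v : U) : (forall x, inner x u = inner x v) -> u = v.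
Proof.
move=> uv; apply/eqP; rewrite -subr_eq0 -(dnorm_eq0 inner) linearBr/=.
by rewrite uv subrr.
Qed.

Fact adjoint_linear : linear adjoint.
Proof.
move=> a y z; apply: inner_injr => x.
by rewrite linearPr/= -!adjointE linearPr.
Qed.

HB.instance Definition _ := GRing.isLinear.Build R[i] V U *:%R adjoint
  adjoint_linear.

Fact adjoint_bounded : exists M : R[i], forall y, `|adjoint y| <= M * `|y|.
Proof.
have [M M0 fM] := bounded_map_ge0 f; exists M => y.
have [->|] := eqVneq (adjoint y) 0; first by rewrite normr0 mulr_ge0.
rewrite -normr_gt0 => y0; rewrite -(ler_pM2r y0) -expr2 inner_norm -adjointE.
rewrite -(@ler_pXn2r _ 2)// ?nnegrE ?mulr_ge0 ?adjointE//.
rewrite -adjointE; apply: (@le_trans _ _ (`|inner (f (adjoint y)) y| ^+ 2)).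
  by rewrite ger0_norm// adjointE.
apply: le_trans (dot_CauchySchwarz _ _ _) _.
rewrite -!inner_norm -exprMn ler_pXn2r ?nnegrE ?mulr_ge0//.
by rewrite [leRHS]mulrAC ler_wpM2r.
Qed.

HB.instance Definition _ := isBoundedMap.Build R V U adjoint adjoint_bounded.

End Adjoint.

Section BlockOperator.
Variables (R : realType) (H K : hilbertType R).
Variables (f11 : {bounded H -> H}) (f12 : {bounded K -> H}).
Variables (f21 : {bounded H -> K}) (f22 : {bounded K -> K}).

Definition block_op (z : hsum H K) : hsum H K :=
  (f11 z.1 + f12 z.2, f21 z.1 + f22 z.2).

Fact block_op_linear : linear block_op.
Proof.
by move=> a z w; congr pair; rewrite /= !linearP scalerDr addrACA.
Qed.

HB.instance Definition _ := GRing.isLinear.Build R[i] (hsum H K) (hsum H K)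
  *:%R block_op block_op_linear.

Fact block_op_bounded :
  exists M : R[i], forall z, `|block_op z| <= M * `|z|.
Proof.
have [M11 M110 h11] := bounded_map_ge0 f11.
have [M12 M120 h12] := bounded_map_ge0 f12.
have [M21 M210 h21] := bounded_map_ge0 f21.
have [M22 M220 h22] := bounded_map_ge0 f22.
exists (M11 + M12 + (M21 + M22)) => z.
apply: le_trans (ler_norm_hsum _) _.
have bnd (X : normedModType R[i]) (u v : X) (M N : R[i]) : 0 <= M -> 0 <= N ->
    `|u| <= M * `|z.1| -> `|v| <= N * `|z.2| -> `|u + v| <= (M + N) * `|z|.
  move=> M0 N0 uM vN; apply: le_trans (ler_normD _ _) _; rewrite mulrDl lerD//.
    by apply: le_trans uM _; rewrite ler_wpM2l// ler_norm_hsum1.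
  by apply: le_trans vN _; rewrite ler_wpM2l// ler_norm_hsum2.
by rewrite [leRHS]mulrDl lerD// bnd.
Qed.

HB.instance Definition _ := isBoundedMap.Build R (hsum H K) (hsum H K)
  block_op block_op_bounded.

End BlockOperator.

Section OperatorNorm.
Variables (R : realType) (U V : normedModType R[i]) (f : {bounded U -> V}).

(* Norms take their (real) values in [R[i]], which is only partially ordered,
   so the supremum is taken in [R] after projecting. *)
Definition opnorm : R :=
  sup [set complex.Re `|f x| | x in [set x : U | `|x| <= 1]].

Lemma ler_opnorm x : `|x| <= 1 -> `|f x| <= opnorm%:C.
Proof.
move=> x1; have [M M0 fM] := bounded_map_ge0 f.
have -> : `|f x| = (complex.Re `|f x|)%:C.
  by apply/esym; apply: RRe_real; apply: ger0_real.
rewrite lecR; apply: ub_le_sup; last by exists x.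
exists (complex.Re M) => _ [y /= y1 <-].
have : `|f y| <= M by apply: le_trans (fM y) _; rewrite ler_piMr.
by rewrite lecE => /andP[].
Qed.

Definition attains_norm : Prop :=
  exists x : U, `|x| = 1 /\ `|f x| = opnorm%:C.

End OperatorNorm.

(* Main.v *)
Require Import Defs.
From HB Require Import structures.
From mathcomp Require Import all_boot all_order all_algebra.
From mathcomp Require Import sesquilinear complex.
From mathcomp Require Import all_classical all_reals all_analysis.
From mathcomp Require Import ring lra.

Set Implicit Arguments.
Unset Strict Implicit.
Unset Printing Implicit Defensive.

Import Order.TTheory GRing.Theory Num.Theory.
Import numFieldNormedType.Exports.

Local Open Scope ring_scope.

(** Write s for the norm of A and, for x in H and y in K, expand

      |T(x,y)|^2 = |a|^2 |x|^2 + |A y|^2 + |c|^2 |A^* x|^2 + |b|^2 |y|^2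
                   + 2 Re (d <x, A y>),   with d = a + c conj(b),

    where the two cross terms have merged because <A^* x, y> = <x, A y>.
    Bounding |A y|, |A^* x| and <x, A y> by means of s gives
    |T(x,y)|^2 <= Q_s(|x|,|y|) for the real quadratic form

      Q_s(p,q) = (|a|^2 + |c|^2 s^2) p^2 + (|b|^2 + s^2) q^2 + 2 |d| s p q

    ([block_op_le_form]).  Conversely, let y be a unit vector with |A y| = t,
    take x a unit vector along A y (any unit vector if t = 0) and turn it by
    the phase of d: then T maps some vector of norm sqrt (p^2 + q^2) to one of
    squared norm at least Q_t(p,q) ([block_op_ge_form]).

    If A attains its norm at y, then t = s, and choosing for (p,q) a unit
    maximizer of Q_s makes the two estimates meet, so T attains its norm
    ([attains_block_op]).

    For the converse suppose s > 0, since a zero operator on a non-zero space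
    attains its norm.  Letting t tend to s yields
    Q_s(p,q) <= |T|^2 (p^2 + q^2) for p, q >= 0 ([block_form_le_opnorm]).  If T
    attains its norm at the unit vector (x,y), then
    |T|^2 = |T(x,y)|^2 <= Q_s(|x|,|y|) <= |T|^2, so every estimate used for
    (x,y) is an equality.  Hence |A y| = s |y|, which settles the case y <> 0.
    When y = 0, the vector x is a unit vector with |c| |A^* x| = |c| s.  If
    c <> 0, then A^* attains its norm at x, and A attains its norm at A^* x.
    If c = 0, then |T| <= |a|, which is refuted by evaluating the
    form at (p,q) = (|a|,s): the entry A makes T strictly larger than its
    corner a ([attains_block_op_inv]). *)

(** * Real-valued norms *)

Section RealNorm.
Variables (R : realType) (V : normedZmodType R[i]).
Implicit Types x y : V.

(** Norms take values in the partially ordered [R[i]]; the estimates below are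
    about ordered reals, where case splits on the order are available. *)
Definition rnorm x : R := complex.Re `|x|.

Lemma rnormE x : `|x| = (rnorm x)%:C%C.
Proof. by rewrite /rnorm RRe_real// ger0_real. Qed.

Lemma rnorm_ge0 x : 0 <= rnorm x.
Proof. by rewrite -ler0c -rnormE. Qed.

Lemma rnorm_eq0 x : (rnorm x == 0) = (x == 0).
Proof. by rewrite -(normr_eq0 x) rnormE fmorph_eq0. Qed.

Lemma rnorm_gt0 x : (0 < rnorm x) = (x != 0).
Proof. by rewrite lt_def rnorm_ge0 andbT rnorm_eq0. Qed.

End RealNorm.

Section Scalars.
Variable R : realType.
Implicit Types (z w : R[i]) (t : R).

Lemma rnormM z w : rnorm (z * w) = rnorm z * rnorm w.
Proof. by apply: complexI; rewrite rmorphM -!rnormE normrM. Qed.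

Lemma rnorm_real t : rnorm (t%:C%C : R[i]) = `|t|.
Proof. by rewrite /rnorm normc_def /= expr0n addr0 sqrtr_sqr. Qed.

Lemma ler_Re_rnorm z : complex.Re z <= rnorm z.
Proof.
apply: le_trans (ler_norm _) _; rewrite -lecR -rnormE; exact: normc_ge_Re.
Qed.

Lemma ReD z w : complex.Re (z + w) = complex.Re z + complex.Re w.
Proof. by case: z w => [? ?] [? ?]. Qed.

Lemma Re_conjc z : complex.Re (z^*)%R = complex.Re z.
Proof. by case: z. Qed.

Lemma exists_phase z : exists2 u : R[i], rnorm u = 1 & z * u = (rnorm z)%:C%C.
Proof.
have [->|z0] := eqVneq z 0.
  exists 1; first by rewrite /rnorm normr1.
  by rewrite mul0r /rnorm normr0.
exists (`|z| / z).
  by rewrite /rnorm normrM normfV normr_id divff// normr_eq0.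
by rewrite -rnormE mulrCA divff// mulr1.
Qed.

End Scalars.

(** * The operator norm and its attainment *)

Section Normalization.
Variables (R : realType) (W : normedModType R[i]).

Lemma rnormZ (l : R[i]) (w : W) :
  rnorm (l *: w) = rnorm l * rnorm w.
Proof. by apply: complexI; rewrite rmorphM/= -!rnormE normrZ. Qed.

Lemma exists_unit_multiple (w : W) : w != 0 ->
  exists2 l : R[i], rnorm l = (rnorm w)^-1 & rnorm (l *: w) = 1.
Proof.
rewrite -rnorm_gt0 => w0.
have lE : rnorm (((rnorm w)^-1)%:C%C : R[i]) = (rnorm w)^-1.
  by rewrite rnorm_real ger0_norm// invr_ge0 ltW.
exists ((rnorm w)^-1)%:C%C => //.
by rewrite rnormZ lE mulVf// gt_eqF.
Qed.

End Normalization.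

Section OperatorNormTheory.
Variables (R : realType) (U V : normedModType R[i]) (f : {bounded U -> V}).
Implicit Types x : U.

Lemma ler_rnorm_opnorm x : rnorm (f x) <= opnorm f * rnorm x.
Proof.
have [->|x0] := eqVneq x 0.
  by rewrite linear0 /rnorm !normr0 /= mulr0.
have [l lE lx] := exists_unit_multiple x0.
have : `|f (l *: x)| <= (opnorm f)%:C%C.
  by apply: ler_opnorm; rewrite rnormE lx.
rewrite rnormE lecR linearZ/= rnormZ lE mulrC ler_pdivrMr//.
by rewrite rnorm_gt0.
Qed.

Lemma opnorm_ge0 : 0 <= opnorm f.
Proof.
have : `|f 0| <= (opnorm f)%:C%C by apply: ler_opnorm; rewrite normr0.
by rewrite linear0 normr0 lecR.
Qed.

(** The operator norm is a supremum over the closed unit ball; when the domain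
    is non-zero, rescaling shows that the unit sphere suffices. *)
Lemma opnorm_le_unit (M : R) : (exists x : U, x != 0) ->
  (forall x, rnorm x = 1 -> rnorm (f x) <= M) -> opnorm f <= M.
Proof.
move=> [x0 x0_neq0] fM.
have M0 : 0 <= M.
  have [l _ lx] := exists_unit_multiple x0_neq0.
  exact: le_trans (rnorm_ge0 _) (fM _ lx).
apply: ge_sup; first by exists (rnorm (f 0)), 0 => //=; rewrite normr0.
move=> _ [x /= x1 <-]; rewrite -/(rnorm (f x)).
have [->|x_neq0] := eqVneq x 0; first by rewrite linear0 /rnorm normr0.
have [l lE lx] := exists_unit_multiple x_neq0.
have := fM _ lx; rewrite linearZ/= rnormZ lE mulrC ler_pdivrMr ?rnorm_gt0//.
move=> /le_trans; apply; rewrite ler_piMr//.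
by move: x1; rewrite rnormE lecR.
Qed.

(** Dropping the normalization of the vector avoids rescaling in each
    application. *)
Lemma attains_normP :
  attains_norm f <-> exists2 x, x != 0 & opnorm f * rnorm x <= rnorm (f x).
Proof.
split=> [[x [x1 fx]]|[x x0 fx]].
  exists x; first by rewrite -normr_eq0 x1 oner_eq0.
  by rewrite /rnorm x1 fx mulr1.
have [l lE lx] := exists_unit_multiple x0.
exists (l *: x); split; first by rewrite rnormE lx.
rewrite rnormE; congr (_%:C)%C; apply/eqP; rewrite eq_le.
have := ler_rnorm_opnorm (l *: x); rewrite lx mulr1 => -> /=.
by rewrite linearZ/= rnormZ lE mulrC ler_pdivlMr// rnorm_gt0.
Qed.

Lemma attains_norm_max (x : U) (M : R) : rnorm x = 1 -> M <= rnorm (f x) ^+ 2 ->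
  (forall z, rnorm (f z) ^+ 2 <= M * rnorm z ^+ 2) -> attains_norm f.
Proof.
move=> x1 Mx fM; have x0 : x != 0 by rewrite -rnorm_gt0 x1.
apply/attains_normP; exists x => //; rewrite x1 mulr1.
apply: opnorm_le_unit; first by exists x.
move=> z z1; rewrite -(@ler_pXn2r _ 2)// ?nnegrE ?rnorm_ge0//.
by apply: le_trans Mx; rewrite (le_trans (fM _))// z1 expr1n mulr1.
Qed.

End OperatorNormTheory.

(** * Inner products and adjoints *)

Section InnerTheory.
Variables (R : realType) (U : hilbertType R).

Lemma inner_rnorm (x : U) : inner x x = (rnorm x ^+ 2)%:C%C.
Proof. by rewrite -inner_norm rnormE rmorphXn. Qed.

Lemma ler_rnorm_inner (x y : U) : rnorm (inner x y) <= rnorm x * rnorm y.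
Proof.
rewrite -(@ler_pXn2r _ 2)// ?nnegrE ?mulr_ge0 ?rnorm_ge0//.
have := dot_CauchySchwarz inner x y.
by rewrite !inner_rnorm rnormE -rmorphXn -rmorphM lecR exprMn.
Qed.

Lemma rnormD_sqr (x y : U) : rnorm (x + y) ^+ 2 =
  rnorm x ^+ 2 + rnorm y ^+ 2 + 2 * complex.Re (inner x y).
Proof.
transitivity (complex.Re (inner (x + y) (x + y))); first by rewrite inner_rnorm.
by rewrite dnormD !ReD Re_conjc !inner_rnorm /=; ring.
Qed.

Lemma exists_norming_vector (v : U) : (exists x : U, x != 0) ->
  exists2 x : U, rnorm x = 1 & inner x v = (rnorm v)%:C%C.
Proof.
move=> [x0 x0_neq0]; have [->|v0] := eqVneq v 0.
  have [l _ lx] := exists_unit_multiple x0_neq0.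
  by exists (l *: x0) => //; rewrite linear0r /rnorm normr0.
have v1 : 0 < rnorm v by rewrite rnorm_gt0.
exists (((rnorm v)^-1)%:C%C *: v).
  by rewrite rnormZ rnorm_real ger0_norm ?invr_ge0 ?ltW// mulVf// gt_eqF.
by rewrite linearZl_LR/= inner_rnorm -rmorphM expr2 mulKf// gt_eqF.
Qed.

End InnerTheory.

Section AdjointTheory.
Variables (R : realType) (U V : hilbertType R) (A : {bounded U -> V}).

Lemma inner_adjointl (x : V) (y : U) : inner (adjoint A x) y = inner x (A y).
Proof.
rewrite (hermC inner (adjoint A x)) (hermC inner x) expr0 !mul1r.
by congr (_^*); apply: esym; exact: adjointE.
Qed.

(** Cauchy-Schwarz for <A^* x, A^* x> = <x, A (A^* x)>.  It yields both the
    bound on A^* and the transfer of norm attainment from A^* to A. *)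
Lemma rnorm_adjoint_sqr (x : V) :
  rnorm (adjoint A x) ^+ 2 <= rnorm (A (adjoint A x)) * rnorm x.
Proof.
rewrite mulrC.
apply: le_trans (ler_rnorm_inner _ _).
apply: le_trans (ler_Re_rnorm _).
by rewrite -inner_adjointl inner_rnorm.
Qed.

Lemma ler_rnorm_adjoint (x : V) :
  rnorm (adjoint A x) <= opnorm A * rnorm x.
Proof.
have [->|] := eqVneq (adjoint A x) 0.
  by rewrite {1}/rnorm normr0 mulr_ge0 ?opnorm_ge0 ?rnorm_ge0.
rewrite -rnorm_gt0 => y0; rewrite -(ler_pM2r y0) -expr2.
apply: le_trans (rnorm_adjoint_sqr x) _.
by rewrite mulrAC ler_wpM2r ?rnorm_ge0// ler_rnorm_opnorm.
Qed.

(** With s the norm of A, s |A^* x| <= |A^* x|^2 <= |A (A^* x)|. *)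
Lemma attains_norm_adjoint (x : V) : 0 < opnorm A -> rnorm x = 1 ->
  opnorm A <= rnorm (adjoint A x) -> attains_norm A.
Proof.
move=> s0 x1 sx; apply/attains_normP; exists (adjoint A x).
  by rewrite -rnorm_gt0 (lt_le_trans s0).
have := rnorm_adjoint_sqr x; rewrite x1 mulr1; apply: le_trans.
by rewrite expr2 ler_wpM2r// rnorm_ge0.
Qed.

End AdjointTheory.

(** * Maximizing a binary quadratic form *)

(** The maximum M on the unit circle is the larger eigenvalue of the symmetric
    matrix (k m; m l).  As (M - k) (M - l) = m^2 with both factors nonnegative,
    M (p^2 + q^2) minus the form is positive semidefinite, and (m, M - k) is an
    eigenvector for M unless it vanishes. *)
Lemma quadratic_form_max (R : rcfType) (k l m : R) :
  exists M p q : R, [/\ p ^+ 2 + q ^+ 2 = 1,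
    k * p ^+ 2 + l * q ^+ 2 + 2 * m * p * q = M &
    forall p' q', k * p' ^+ 2 + l * q' ^+ 2 + 2 * m * p' * q'
      <= M * (p' ^+ 2 + q' ^+ 2)].
Proof.
have D0 : 0 <= (k - l) ^+ 2 + 4 * m ^+ 2.
  by have := sqr_ge0 (k - l); have := sqr_ge0 m; lra.
have := sqr_sqrtr D0; have := sqrtr_ge0 ((k - l) ^+ 2 + 4 * m ^+ 2).
set r := Num.sqrt _ => r0 rE.
pose M := (k + l + r) / 2.
have mE : m ^+ 2 = (M - k) * (M - l) by rewrite /M; nra.
have kl : (M - k) + (M - l) = r by rewrite /M; lra.
clearbody M.
have kM : 0 <= M - k by rewrite leNgt; apply/negP => h; have := sqr_ge0 m; nra.
have lM : 0 <= M - l by rewrite leNgt; apply/negP => h; have := sqr_ge0 m; nra.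
have maxM p' q' : k * p' ^+ 2 + l * q' ^+ 2 + 2 * m * p' * q'
    <= M * (p' ^+ 2 + q' ^+ 2).
  suff: 2 * m * p' * q' <= (M - k) * p' ^+ 2 + (M - l) * q' ^+ 2 by lra.
  have w0 : 0 <= (M - k) * p' ^+ 2 + (M - l) * q' ^+ 2.
    by rewrite addr_ge0// mulr_ge0// sqr_ge0.
  apply: le_trans (ler_norm _) _; rewrite -(@ler_pXn2r _ 2)// ?nnegrE//.
  rewrite real_normK ?num_real// -subr_ge0.
  suff -> : ((M - k) * p' ^+ 2 + (M - l) * q' ^+ 2) ^+ 2
      - (2 * m * p' * q') ^+ 2
    = ((M - k) * p' ^+ 2 - (M - l) * q' ^+ 2) ^+ 2 by exact: sqr_ge0.
  by ring: mE.
exists M.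
(* If the eigenvector vanishes, then m = 0 and M = k, so (1,0) is maximal. *)
have [v0|] := eqVneq (m ^+ 2 + (M - k) ^+ 2) 0.
  exists 1, 0; split=> //; first by ring.
  have : M - k = 0.
    apply/eqP; rewrite -sqrf_eq0; apply/eqP.
    have := sqr_ge0 m; have := sqr_ge0 (M - k); lra.
  by lra.
have := addr_ge0 (sqr_ge0 m) (sqr_ge0 (M - k)) => n0 n_neq0.
have ngt0 : 0 < Num.sqrt (m ^+ 2 + (M - k) ^+ 2).
  by rewrite sqrtr_gt0 lt_def n_neq0.
have nE := sqr_sqrtr n0; move: ngt0 nE; set n := Num.sqrt _ => ngt0 nE.
have nn : n != 0 by rewrite gt_eqF.
exists (m / n), ((M - k) / n); split=> //.
  by rewrite !expr_div_n -mulrDl -nE divff// expf_neq0.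
apply: (@mulIf _ (n ^+ 2)); first by rewrite expf_neq0.
rewrite {2}nE; field: mE => //.
Qed.

(** * Estimates for the block operator *)

Section BlockMatrix.
Variables (R : realType) (H K : hilbertType R).
Variables (A : {bounded K -> H}) (a b c : R[i]).

Let T : {bounded hsum H K -> hsum H K} :=
  block_op (a \*: idfun : {bounded H -> H}) A
           (c \*: adjoint A) (b \*: idfun : {bounded K -> K}).

(** The coefficient of <x, A y> in |T(x,y)|^2: the first coordinate of T(x,y)
    contributes a and the second c conj(b). *)
Definition coupling : R[i] := a + c * (b^*)%R.

(** The quadratic form Q_s described at the top; p and q stand for the norms
    of the two coordinates and s for that of A. *)
Definition block_form (s p q : R) : R :=
  (rnorm a ^+ 2 + rnorm c ^+ 2 * s ^+ 2) * p ^+ 2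
  + (rnorm b ^+ 2 + s ^+ 2) * q ^+ 2
  + 2 * (rnorm coupling * s) * p * q.

Lemma rnorm_hsum_sqr (z : hsum H K) :
  rnorm z ^+ 2 = rnorm z.1 ^+ 2 + rnorm z.2 ^+ 2.
Proof.
apply: complexI; rewrite rmorphD !rmorphXn/= -!rnormE; exact: hsum_norm_sqr.
Qed.

Lemma rnorm_block_op_sqr (x : H) (y : K) :
  rnorm (T (x, y)) ^+ 2 =
  rnorm a ^+ 2 * rnorm x ^+ 2 + rnorm (A y) ^+ 2
  + rnorm c ^+ 2 * rnorm (adjoint A x) ^+ 2 + rnorm b ^+ 2 * rnorm y ^+ 2
  + 2 * complex.Re (coupling * inner x (A y)).
Proof.
rewrite rnorm_hsum_sqr /= !rnormD_sqr !rnormZ !exprMn.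
have -> : inner (a *: x) (A y) = a * inner x (A y) by rewrite linearZl_LR.
have -> : inner (c *: adjoint A x) (b *: y) = c * (b^*)%R * inner x (A y).
  by rewrite linearZl_LR linearZr_LR/= inner_adjointl mulrA.
by rewrite /coupling (mulrDl a) ReD; ring.
Qed.

(** A quantitative substitute for the continuity of Q_s in s: for p, q >= 0
    every term of Q_s has degree at most 2 in s and a nonnegative coefficient,
    so replacing s by r s with 0 <= r <= 1 shrinks Q_s by a factor r^2 at
    worst. *)
Lemma ler_block_form_sqr (s t p q : R) : 0 <= t <= s -> 0 <= p -> 0 <= q ->
  t ^+ 2 * block_form s p q <= s ^+ 2 * block_form t p q.
Proof.
move=> /andP[t0 ts] p0 q0; have s0 : 0 <= s := le_trans t0 ts.
have d0 := rnorm_ge0 coupling; rewrite -subr_ge0 /block_form.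
move: (rnorm a) (rnorm b) (rnorm c) (rnorm coupling) d0 => al be ga d d0.
have -> : s ^+ 2 * ((al ^+ 2 + ga ^+ 2 * t ^+ 2) * p ^+ 2
    + (be ^+ 2 + t ^+ 2) * q ^+ 2 + 2 * (d * t) * p * q)
  - t ^+ 2 * ((al ^+ 2 + ga ^+ 2 * s ^+ 2) * p ^+ 2
    + (be ^+ 2 + s ^+ 2) * q ^+ 2 + 2 * (d * s) * p * q)
  = (s ^+ 2 - t ^+ 2) * ((al * p) ^+ 2 + (be * q) ^+ 2)
    + 2 * d * s * t * (p * q) * (s - t) by ring.
apply: addr_ge0; last by rewrite !mulr_ge0// subr_ge0.
apply: mulr_ge0; last by rewrite addr_ge0 ?sqr_ge0.
by rewrite subr_ge0 ler_pXn2r ?nnegrE.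
Qed.

Lemma block_op_le_form (z : hsum H K) :
  rnorm (T z) ^+ 2 <= block_form (opnorm A) (rnorm z.1) (rnorm z.2).
Proof.
case: z => x y; rewrite rnorm_block_op_sqr /block_form /=.
have Ay := ler_rnorm_opnorm A y; have Ax := ler_rnorm_adjoint A x.
have s0 := opnorm_ge0 A; have x0 := rnorm_ge0 x; have y0 := rnorm_ge0 y.
have Ay2 : rnorm (A y) ^+ 2 <= (opnorm A * rnorm y) ^+ 2.
  by rewrite ler_pXn2r ?nnegrE ?mulr_ge0 ?rnorm_ge0.
have Ax2 : rnorm c ^+ 2 * rnorm (adjoint A x) ^+ 2
    <= rnorm c ^+ 2 * (opnorm A * rnorm x) ^+ 2.
  by rewrite ler_wpM2l ?sqr_ge0// ler_pXn2r ?nnegrE ?mulr_ge0 ?rnorm_ge0.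
have dxy : complex.Re (coupling * inner x (A y))
    <= rnorm coupling * (rnorm x * (opnorm A * rnorm y)).
  apply: le_trans (ler_Re_rnorm _) _; rewrite rnormM ler_wpM2l ?rnorm_ge0//.
  by apply: le_trans (ler_rnorm_inner _ _) _; rewrite ler_wpM2l.
move: Ay2 Ax2 dxy; rewrite !exprMn; lra.
Qed.

(** The test vector is (p u x, q y), where x is a unit vector along A y, so
    that <x, A y> = |A y|, and u is a phase making d u = |d|.  Then
    |A^* x| >= |<A^* x, y>| = |A y| gives the remaining term of the form. *)
Lemma block_op_ge_form (y : K) (p q : R) : (exists x : H, x != 0) ->
  rnorm y = 1 -> exists2 z : hsum H K, rnorm z ^+ 2 = p ^+ 2 + q ^+ 2 &
    block_form (rnorm (A y)) p q <= rnorm (T z) ^+ 2.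
Proof.
move=> H_neq0 y1; have [x x1 xE] := exists_norming_vector (A y) H_neq0.
have [u u1 uE] := exists_phase coupling.
exists (p%:C%C * u *: x, q%:C%C *: y).
  rewrite rnorm_hsum_sqr/= !rnormZ rnormM !rnorm_real x1 y1 u1 !mulr1.
  by rewrite !real_normK ?num_real.
have Ax : rnorm (A y) <= rnorm (adjoint A x).
  have := ler_rnorm_inner (adjoint A x) y; rewrite y1 mulr1 inner_adjointl.
  by rewrite xE rnorm_real ger0_norm// rnorm_ge0.
rewrite rnorm_block_op_sqr /block_form.
have qE : ((q%:C%C : R[i])^*)%R = q%:C%C by exact: conjc_real.
have -> : inner ((p%:C%C * u) *: x) (A (q%:C%C *: y))
    = u * (p * (q * rnorm (A y)))%:C%C.
  rewrite [A _]linearZ linearZl_LR linearZr_LR/= xE !rmorphM/= qE.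
  by ring.
rewrite !linearZ/= !rnormZ rnormM !rnorm_real.
rewrite (mulrA coupling) uE -rmorphM/= x1 y1 u1 !mulr1 !exprMn.
rewrite !real_normK ?num_real//.
have : rnorm c ^+ 2 * p ^+ 2 * rnorm (A y) ^+ 2
    <= rnorm c ^+ 2 * p ^+ 2 * rnorm (adjoint A x) ^+ 2.
  apply: ler_wpM2l; first by rewrite mulr_ge0 ?sqr_ge0.
  by rewrite ler_pXn2r ?nnegrE ?rnorm_ge0.
lra.
Qed.

(** * Attainment of the norm *)

Lemma attains_block_op :
  (exists x : H, x != 0) -> attains_norm A -> attains_norm T.
Proof.
move=> H_neq0 [y [yn1 Ay]].
have y1 : rnorm y = 1 by rewrite /rnorm yn1.
have [M [p [q [pq1 ME Mmax]]]] := quadratic_form_max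
  (rnorm a ^+ 2 + rnorm c ^+ 2 * opnorm A ^+ 2)
  (rnorm b ^+ 2 + opnorm A ^+ 2) (rnorm coupling * opnorm A).
have [z zE Tz] := block_op_ge_form p q H_neq0 y1.
have z1 : rnorm z = 1.
  by apply/eqP; rewrite -(@pexpr_eq1 _ _ 2)// ?rnorm_ge0// zE pq1.
apply: (attains_norm_max z1 (M := M)).
  by rewrite -ME; move: Tz; rewrite {1}/rnorm Ay.
move=> w; rewrite [rnorm w ^+ 2]rnorm_hsum_sqr.
exact: le_trans (block_op_le_form w) (Mmax _ _).
Qed.

(** If the value Q of the form at (p,q) exceeded C = |T|^2 (p^2 + q^2), the
    test vectors would give |A y|^2 Q <= s^2 C, that is
    |A y| <= s sqrt (C / Q), for all unit y, and so s <= s sqrt (C / Q) < s. *)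
Lemma block_form_le_opnorm (p q : R) :
  (exists x : H, x != 0) -> (exists y : K, y != 0) ->
  0 < opnorm A -> 0 <= p -> 0 <= q ->
  block_form (opnorm A) p q <= opnorm T ^+ 2 * (p ^+ 2 + q ^+ 2).
Proof.
move=> H_neq0 K_neq0 s0 p0 q0; rewrite leNgt; apply/negP.
set C := opnorm T ^+ 2 * _; set Q := block_form _ _ _ => CQ.
have C0 : 0 <= C by rewrite mulr_ge0 ?addr_ge0 ?sqr_ge0.
have Q0 : 0 < Q := le_lt_trans C0 CQ.
have CQ0 : 0 <= C / Q by rewrite divr_ge0// ltW.
have : opnorm A <= opnorm A * Num.sqrt (C / Q).
  apply: opnorm_le_unit => // y y1.
  have Ay : rnorm (A y) <= opnorm A.
    by have := ler_rnorm_opnorm A y; rewrite y1 mulr1.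
  rewrite -(@ler_pXn2r _ 2)// ?nnegrE; first last.
  - by rewrite mulr_ge0 ?sqrtr_ge0 ?ltW.
  - exact: rnorm_ge0.
  rewrite exprMn sqr_sqrtr// mulrA ler_pdivlMr//.
  apply: (@le_trans _ _ (opnorm A ^+ 2 * block_form (rnorm (A y)) p q)).
    by apply: ler_block_form_sqr; rewrite ?rnorm_ge0.
  rewrite ler_wpM2l ?sqr_ge0//.
  have [z zE Tz] := block_op_ge_form p q H_neq0 y1.
  apply: le_trans Tz _; rewrite /C -zE -exprMn.
  rewrite ler_pXn2r ?nnegrE ?mulr_ge0 ?rnorm_ge0 ?opnorm_ge0//.
  exact: ler_rnorm_opnorm.
rewrite ler_pMr// leNgt => /negP; apply.
rewrite -(@ltr_pXn2r _ 2)// ?nnegrE ?sqrtr_ge0//.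
by rewrite sqr_sqrtr// expr1n ltr_pdivrMr// mul1r.
Qed.

Lemma attains_block_op_inv :
  (exists x : H, x != 0) -> (exists y : K, y != 0) ->
  attains_norm T -> attains_norm A.
Proof.
move=> H_neq0 K_neq0.
have [s_eq0|s_neq0] := eqVneq (opnorm A) 0.
  move=> _; have [y y0] := K_neq0; apply/attains_normP; exists y => //.
  by rewrite s_eq0 mul0r rnorm_ge0.
have s0 : 0 < opnorm A by rewrite lt_def s_neq0 opnorm_ge0.
move=> [[x y] [zn1 Tz]].
have xy1 : rnorm x ^+ 2 + rnorm y ^+ 2 = 1.
  by rewrite -(rnorm_hsum_sqr (x, y)) /rnorm zn1 expr1n.
have NE : opnorm T ^+ 2 = rnorm (T (x, y)) ^+ 2
  by rewrite [rnorm (T _)]/rnorm Tz.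
have := block_form_le_opnorm H_neq0 K_neq0 s0 (rnorm_ge0 x) (rnorm_ge0 y).
rewrite xy1 mulr1 NE rnorm_block_op_sqr /block_form => Nle.
have Ay := ler_rnorm_opnorm A y; have Ax := ler_rnorm_adjoint A x.
have dxy : complex.Re (coupling * inner x (A y))
    <= rnorm coupling * (rnorm x * rnorm (A y)).
  apply: le_trans (ler_Re_rnorm _) _; rewrite rnormM ler_wpM2l ?rnorm_ge0//.
  exact: ler_rnorm_inner.
have [y_eq0|y0] := eqVneq y 0; last first.
  apply/attains_normP; exists y => //; rewrite leNgt; apply/negP => Ay_lt.
  have Ay2 : rnorm (A y) ^+ 2 < (opnorm A * rnorm y) ^+ 2.
    by rewrite ltr_pXn2r ?nnegrE ?mulr_ge0 ?rnorm_ge0 ?opnorm_ge0.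
  have Ax2 : rnorm c ^+ 2 * rnorm (adjoint A x) ^+ 2
      <= rnorm c ^+ 2 * (opnorm A * rnorm x) ^+ 2.
    rewrite ler_wpM2l ?sqr_ge0// ler_pXn2r ?nnegrE// ?mulr_ge0//;
      by rewrite ?rnorm_ge0 ?opnorm_ge0.
  have dAy : rnorm coupling * (rnorm x * rnorm (A y))
      <= rnorm coupling * (rnorm x * (opnorm A * rnorm y)).
    by rewrite !ler_wpM2l ?rnorm_ge0.
  by move: Nle Ay2 Ax2 dxy dAy; rewrite !exprMn; lra.
have yr : rnorm y = 0 by apply/eqP; rewrite rnorm_eq0 y_eq0.
have Ayr : rnorm (A y) = 0 by apply/eqP; rewrite rnorm_eq0 y_eq0 linear0.
have x1 : rnorm x = 1.
  by apply/eqP; rewrite -(@pexpr_eq1 _ _ 2)// ?rnorm_ge0// -xy1 yr expr0n addr0.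
have [c_eq0|c0] := eqVneq c 0.
  have cr : rnorm c = 0 by apply/eqP; rewrite rnorm_eq0 c_eq0.
  have dE : coupling = a by rewrite /coupling c_eq0 mul0r addr0.
  (* Here |T| <= |a|, whereas Q_s(|a|,s) > |a|^2 (|a|^2 + s^2). *)
  have := block_form_le_opnorm H_neq0 K_neq0 s0 (rnorm_ge0 a) (ltW s0).
  have : opnorm T ^+ 2 <= rnorm a ^+ 2.
    move: dxy; rewrite NE rnorm_block_op_sqr cr yr Ayr x1; lra.
  rewrite /block_form dE cr; have := rnorm_ge0 a; move: (rnorm a) => al al0 Nal.
  have al2 : 0 <= al ^+ 2 := sqr_ge0 al.
  have s2 : 0 < opnorm A ^+ 2 by rewrite exprn_gt0.
  have b2 := sqr_ge0 (rnorm b).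
  have bs := mulr_ge0 b2 (ltW s2).
  have as2 := mulr_ge0 al2 (ltW s2).
  have := ler_wpM2r (addr_ge0 al2 (ltW s2)) Nal.
  have := mulr_gt0 s2 s2; lra.
apply: (attains_norm_adjoint s0 x1); rewrite leNgt; apply/negP => Ax_lt.
have : rnorm c ^+ 2 * rnorm (adjoint A x) ^+ 2
    < rnorm c ^+ 2 * opnorm A ^+ 2.
  rewrite ltr_pM2l ?exprn_gt0 ?rnorm_gt0//.
  by rewrite ltr_pXn2r ?nnegrE ?rnorm_ge0 ?opnorm_ge0.
by move: Nle dxy; rewrite yr Ayr x1; lra.
Qed.

End BlockMatrix.

Theorem theorem2p5 (R : realType) (H K : hilbertType R)
    (H_neq0 : exists x : H, x != 0) (K_neq0 : exists y : K, y != 0)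
    (A : {bounded K -> H}) (a b c : R[i]) :
  let T : {bounded hsum H K -> hsum H K} :=
    block_op (a \*: idfun : {bounded H -> H}) A
             (c \*: adjoint A) (b \*: idfun : {bounded K -> K}) in
  attains_norm T <-> attains_norm A.
Proof.
by split; [exact: attains_block_op_inv|exact: attains_block_op].
Qed.
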